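(* There exists an absolute constant $c>0$ such that for every positive integer $k$, setting $n=2^{2k}+1$, one has $T(n)\ge n^{cn}$. (That is, $T(n)\ge n^{\Omega(n)}$ for $n$ of the form $4^k+1$.)
   Context: Index the rows and columns of an $n\times n$ board by $\mathbb{Z}_n$. A toroidal $n$-queens configuration is a set $\{(x_i,y_i)\}_{i=1}^n\subseteq \mathbb{Z}_n^2$ such that each of the multisets $\{x_i\}$, $\{y_i\}$, $\{x_i+y_i\}$, $\{x_i-y_i\}$ equals $\mathbb{Z}_n$ (i.e. no two queens share a row, a column, or a toroidal diagonal $\{x+y=c\}$ or $\{x-y=c\}$). $T(n)$ denotes the number of toroidal $n$-queens configurations. *)

(* Defs.v *)
From mathcomp Require Import all_boot all_order all_algebra.

Set Implicit Arguments.
Unset Strict Implicit.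
Unset Printing Implicit Defensive.

Import GRing.Theory.
Local Open Scope ring_scope.

(* Equality of multisets is [perm_eq] of enumerations: [[seq F p | p in Q]]   *)
(* lists F p once for each p in Q, repetitions included. In particular any    *)
(* configuration has exactly n queens.                                        *)
(* 'Z_n is the ring of integers modulo n only for n >= 2; the definitions     *)
(* below are not meaningful for n = 0, 1.                                     *)
Definition toroidal_queens (n : nat) (Q : {set 'Z_n * 'Z_n}) : bool :=
  [&& perm_eq [seq p.1 | p in Q] (enum 'Z_n),
      perm_eq [seq p.2 | p in Q] (enum 'Z_n),
      perm_eq [seq p.1 + p.2 | p in Q] (enum 'Z_n)
    & perm_eq [seq p.1 - p.2 | p in Q] (enum 'Z_n)].

Definition T (n : nat) : nat := #|[set Q | @toroidal_queens n Q]|.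

(* Main.v *)
(* Since i = 2^k is a square root of -1 in Z_n, with n odd, the line y = i x is
   a toroidal configuration. A board point with x-coordinate c + z and
   y-coordinate i (c - z) shares its row, column and two diagonals with the
   queens of the line at c + z, c - z, c - i z and c + i z, the vertices of a
   "square". So in the line the four queens over a square can be replaced by
   the four board points obtained by swapping opposite vertices, and this can
   be done independently for disjoint squares. A vertex s lies on n squares (one
   for each half-diagonal z, possibly 0), and a set of m used vertices blocks at
   most 3 m of them, so about n/24 successive squares can be chosen with at
   least n/2 choices each. *)
Require Import Defs.
From mathcomp Require Import all_boot all_order all_algebra.
From mathcomp Require Import reals exp.
From mathcomp Require Import ring zify.

Import Order.TTheory GRing.Theory Num.Theory.
Local Open Scope ring_scope.

Lemma leq_card_setU_add (X : finType) (B C : {set X}) (m p : nat) :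
  (#|B| <= m)%N -> (#|C| <= p)%N -> (#|B :|: C| <= m + p)%N.
Proof.
by move=> leB leC; rewrite cardsU (leq_trans (leq_subr _ _)) ?leq_add.
Qed.

Section SquareSwitching.

Variables (A : finComUnitRingType) (i : A).
Hypotheses (sqr_i : i * i = -1) (unit2 : (2 : A) \is a GRing.unit).

Definition square (c z : A) : {set A} :=
  [set c + z; c - z; c + i * z; c - i * z].

(** Multiplication by [i] is a quarter turn, since [i * i = -1]; [g] is used with the values [-1],
    [i] and [- i]. *)
Definition rotate (c z g x : A) : A :=
  if x \in square c z then c + g * (x - c) else x.

(* [f] encodes the configuration of the points [(x, i * f x)], so that the line
   [y = i x] is the identity. *)
Definition queen_fun (f : {ffun A -> A}) : bool :=
  [&& injectiveb f, injectiveb (fun x => x + i * f x)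
    & injectiveb (fun x => x - i * f x)].

(** [U] holds the vertices of squares still to be switched: over them the queens must lie on the
    line. *)
Definition queens_fixing (U : {set A}) : {set {ffun A -> A}} :=
  [set f | queen_fun f & [forall x in U, f x == x]].

Definition switch (c z : A) (f : {ffun A -> A}) : {ffun A -> A} :=
  [ffun x => f (rotate c z (-1) x)].

Lemma unit_1i : (1 + i \is a GRing.unit) && (1 - i \is a GRing.unit).
Proof.
rewrite -unitrM (_ : _ * _ = 1 - i * i); last by ring.
by rewrite sqr_i opprK.
Qed.

Lemma unit_1Di : 1 + i \is a GRing.unit.
Proof. by case/andP: unit_1i. Qed.

Lemma unit_1Bi : 1 - i \is a GRing.unit.
Proof. by case/andP: unit_1i. Qed.

Lemma unit_i : i \is a GRing.unit.
Proof. by apply/unitrPr; exists (- i); rewrite mulrN sqr_i opprK. Qed.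

Lemma mul_ii x : i * (i * x) = - x.
Proof. by rewrite mulrA sqr_i mulN1r. Qed.

Lemma square_rot c z x : x \in square c z -> c + i * (x - c) \in square c z.
Proof.
rewrite !inE -!orbA => /or4P[] /eqP->; rewrite addrAC subrr add0r.
- by rewrite eqxx !orbT.
- by rewrite mulrN eqxx !orbT.
- by rewrite mul_ii eqxx !orbT.
- by rewrite mulrN mul_ii opprK eqxx.
Qed.

Lemma square_opp c z x : x \in square c z -> c + -1 * (x - c) \in square c z.
Proof.
move=> /square_rot/square_rot.
by rewrite [c + i * _ - c]addrAC subrr add0r mul_ii mulN1r.
Qed.

Lemma square_rotN c z x :
  x \in square c z -> c + - i * (x - c) \in square c z.
Proof.
move=> /square_rot/square_opp.
by rewrite [c + i * _ - c]addrAC subrr add0r mulN1r mulNr.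
Qed.

Lemma rotate_inj c z g : g \is a GRing.unit ->
  (forall x, x \in square c z -> c + g * (x - c) \in square c z) ->
  injective (rotate c z g).
Proof.
move=> gU gS x y; rewrite /rotate.
case: ifPn => xS; case: ifPn => yS //.
- by move=> /addrI/(mulrI gU)/addIr.
- by move=> e; move: yS; rewrite -e gS.
- by move=> e; move: xS; rewrite e gS.
Qed.

Lemma queens_fixingP (U : {set A}) (f : {ffun A -> A}) :
  reflect [/\ injective f, injective (fun x => x + i * f x),
    injective (fun x => x - i * f x) & {in U, forall x, f x = x}]
    (f \in queens_fixing U).
Proof.
rewrite inE; apply: (iffP andP).
  case=> /and3P[/injectiveP f1 /injectiveP f2 /injectiveP f3] /forall_inP f4.
  by split=> // x /f4/eqP.
case=> f1 f2 f3 f4; split; last by apply/forall_inP => x /f4/eqP.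
by apply/and3P; split; apply/injectiveP.
Qed.

(* Row, column and diagonals of the queen at [x] after switching are those of
   the old queens at [x] turned about [c] by 0, 180 and -90, 90 degrees. *)
Lemma switch_queens c z (U : {set A}) f : [disjoint square c z & U] ->
  f \in queens_fixing (U :|: square c z) -> switch c z f \in queens_fixing U.
Proof.
move=> dis /queens_fixingP[f1 f2 f3 f4].
have fS x : x \in square c z -> f x = x by move=> xS; rewrite f4 // inE xS orbT.
apply/queens_fixingP; split.
- move=> x y; rewrite !ffunE => /f1; apply: rotate_inj; first exact: unitrN1.
  exact: square_opp.
- have E x : x + i * switch c z f x =
      rotate c z (- i) x + i * f (rotate c z (- i) x).
    rewrite ffunE /rotate; case: ifPn => // xS.
    rewrite !fS ?square_opp ?square_rotN //.
    rewrite [RHS](_ : _ = c - i * (x - c) + i * c - i * i * (x - c)).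
      by rewrite sqr_i; ring.
    by ring.
  move=> x y; rewrite !E => /f2; apply: rotate_inj.
    by rewrite unitrN unit_i.
  exact: square_rotN.
- have E x : x - i * switch c z f x =
      rotate c z i x - i * f (rotate c z i x).
    rewrite ffunE /rotate; case: ifPn => // xS.
    rewrite !fS ?square_opp ?square_rot //.
    rewrite [RHS](_ : _ = c + i * (x - c) - i * c - i * i * (x - c)).
      by rewrite sqr_i; ring.
    by ring.
  move=> x y; rewrite !E => /f3; apply: rotate_inj; first exact: unit_i.
  exact: square_rot.
- move=> x xU; rewrite ffunE /rotate ifN; first by rewrite f4 // inE xU.
  by apply/negP => xS; rewrite (disjointFr dis xS) in xU.
Qed.

(** Off the square switching changes nothing, and on it both functions are the identity. *)
Lemma switch_inj c z (U : {set A}) :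
  {in queens_fixing (U :|: square c z) &, injective (switch c z)}.
Proof.
move=> f g /queens_fixingP[_ _ _ f4] /queens_fixingP[_ _ _ g4] /ffunP e.
apply/ffunP => x; case: (boolP (x \in square c z)) => xS.
  by rewrite f4 ?g4 // inE xS orbT.
by have := e x; rewrite !ffunE /rotate ifN.
Qed.

Lemma id_queens_fixing (U : {set A}) : [ffun x => x] \in queens_fixing U.
Proof.
apply/queens_fixingP; split=> [x y|x y|x y|x _]; rewrite ?ffunE //.
- rewrite (_ : x + _ = (1 + i) * x) 1?(_ : y + _ = (1 + i) * y); try by ring.
  exact: (mulrI unit_1Di).
- rewrite (_ : x - _ = (1 - i) * x) 1?(_ : y - _ = (1 - i) * y); try by ring.
  exact: (mulrI unit_1Bi).
Qed.

(** The centre [s - z] makes [s] a vertex of the square. *)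
Definition free_radii (s : A) (U : {set A}) : {set A} :=
  [set z | [disjoint square (s - z) z & U]].

(** The other vertices are [s - 2 * z], [s - (1 - i) * z] and [s - (1 + i) * z]. These coefficients
    are units, so each point of [U] excludes at most one [z] per vertex. *)
Lemma card_free_radii s (U : {set A}) : s \notin U ->
  (#|A| <= #|free_radii s U| + 3 * #|U|)%N.
Proof.
move=> sU; rewrite -(cardsC (free_radii s U)) leq_add2l.
pose img (d : A) := [set d^-1 * (s - u) | u in U].
have card_img d : (#|img d| <= #|U|)%N by exact: leq_imset_card.
have in_img d z u :
    d \is a GRing.unit -> u \in U -> u = s - d * z -> z \in img d.
  move=> dU uU e; apply/imsetP; exists u => //.
  by rewrite e opprB addrC subrK mulKr.
have sub : ~: free_radii s U \subset
    img 2 :|: (img (1 - i) :|: img (1 + i)).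
  apply/subsetP => z; rewrite 2!inE -setI_eq0 => /set0Pn[u /setIP[]].
  rewrite !inE -!orbA => /or4P[] /eqP eu uU.
  - by rewrite eu subrK (negPf sU) in uU.
  - by rewrite (in_img 2 z u) // eu; ring.
  - by rewrite (in_img (1 - i) z u) ?orbT ?unit_1Bi // eu; ring.
  - by rewrite (in_img (1 + i) z u) ?orbT ?unit_1Di // eu; ring.
apply: (leq_trans (subset_leq_card sub)).
rewrite !mulSn mul0n addn0.
by do 2![apply: leq_card_setU_add => //].
Qed.

Lemma card_square c z : (#|square c z| <= 4)%N.
Proof.
rewrite -[4%N]/(1 + 1 + 1 + 1)%N.
by do 3![apply: leq_card_setU_add; rewrite ?cards1 //].
Qed.

(* Switching along the square with half-diagonal [z] at [s] sends [s] to
   [s - 2 z], so [z] can be read off the resulting function. *)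
Lemma sum_queens_fixing s (U : {set A}) :
  (\sum_(z in free_radii s U) #|queens_fixing (U :|: square (s - z)%R z)|
     <= #|queens_fixing U|)%N.
Proof.
pose radius (f : {ffun A -> A}) := 2^-1 * (s - f s).
rewrite -[leqRHS]sum1_card (partition_big radius predT) //=.
rewrite [leqRHS](bigID (mem (free_radii s U))) /=.
apply: leq_trans (leq_addr _ _); apply: leq_sum => z.
rewrite inE => dis.
rewrite -(card_in_imset (@switch_inj (s - z) z U)) sum1dep_card.
apply/subset_leq_card/subsetP => _ /imsetP[f fQ ->].
rewrite in_set (switch_queens _ _ _ _ dis fQ) /=.
have sS : s \in square (s - z) z by rewrite !inE subrK eqxx.
have /queens_fixingP[_ _ _ f4] := fQ.
rewrite /radius ffunE /rotate sS f4; last by rewrite inE square_opp ?orbT.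
rewrite (_ : s - _ = 2 * z) ?mulKr //; by ring.
Qed.

(** Each square adds at most 4 points to [U], each blocking at most 3 radii, so it costs the later
    choices at most 12 radii. The [+ 12] on the right is there because nothing is chosen after the
    last square. *)
Lemma card_queens_fixing K m (U : {set A}) :
  (K + 3 * #|U| + 12 * m <= #|A| + 12)%N ->
  (K ^ m <= #|queens_fixing U|)%N.
Proof.
elim: m U => [|m IHm] U le_K.
  by apply/card_gt0P; exists [ffun x => x]; exact: id_queens_fixing.
(* For [K > 0] the bound forces [#|U| < #|A|], which leaves a vertex [s] outside [U]. *)
have [->|K_gt0] := posnP K; first by rewrite exp0n.
have [s sU] : exists s, s \notin U.
  apply/existsP; rewrite -negb_forall; apply/negP => /forallP allU.
  have: #|U| = #|A| by apply: eq_card => x; rewrite allU.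
  by lia.
apply: leq_trans (sum_queens_fixing s U).
apply: (@leq_trans (\sum_(z in free_radii s U) K ^ m)); last first.
  apply: leq_sum => z _; apply: IHm.
  have := leq_card_setU_add _ _ _ _ _ (leqnn #|U|) (card_square (s - z) z).
  by lia.
rewrite sum_nat_const expnS leq_mul2r; apply/orP; right.
have := card_free_radii s U sU; lia.
Qed.

End SquareSwitching.

(** An injective self-map of a finite type is a bijection, so it takes every value exactly once. *)
Lemma perm_eq_image_enum (S : finType) (X : finType) (h : X -> S) (F : S -> X) :
  injective (F \o h) -> perm_eq [seq F p | p in [set h x | x in X]] (enum X).
Proof.
move=> Fh_inj; apply: uniq_perm; last first.
- move=> y; rewrite mem_enum inE; apply/imageP.
  have [g _ gK] := injF_bij Fh_inj.
  by exists (h (g y)); [exact: imset_f | rewrite -[LHS]gK].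
- exact: enum_uniq.
rewrite map_inj_in_uniq ?enum_uniq // => p q.
rewrite !mem_enum => /imsetP[x _ ->] /imsetP[y _ ->] e.
by rewrite (Fh_inj x y).
Qed.

Lemma card_queens_fixing_T n (i : 'Z_n) : i * i = -1 ->
  (#|queens_fixing _ i set0| <= T n)%N.
Proof.
move=> sqr_i.
have iU : i \is a GRing.unit by exact: unit_i.
pose board (f : {ffun 'Z_n -> 'Z_n}) := [set (x, i * f x) | x : 'Z_n].
have board_inj : injective board.
  move=> f g e; apply/ffunP => x.
  have : (x, i * f x) \in board g by rewrite -e imset_f.
  case/imsetP=> y _ /eqP; rewrite xpair_eqE => /andP[/eqP <- /eqP].
  exact: (mulrI iU).
rewrite -(card_imset _ board_inj); apply/subset_leq_card/subsetP.
move=> _ /imsetP[f /queens_fixingP[f1 f2 f3 _] ->]; rewrite inE.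
apply/and4P; split; apply: perm_eq_image_enum => //= x y //=.
by move=> /(mulrI iU)/f1.
Qed.

Lemma T_lower_bound k n : (0 < k)%N -> n = (2 ^ (2 * k) + 1)%N ->
  (n ^ (n %/ 24).+1 <= T n ^ 2)%N.
Proof.
move=> k_gt0 nE.
have n_gt1 : (1 < n)%N by rewrite nE addn1 ltnS expn_gt0.
pose i : 'Z_n := (2 ^ k)%:R.
have sqr_i : i * i = -1.
  apply/eqP; rewrite -addr_eq0 -natrM -expnD addnn -mul2n -(natrD _ _ 1) -nE.
  by rewrite pchar_Zp.
have unit2 : (2 : 'Z_n) \is a GRing.unit.
  rewrite unitZpE // nE coprime_sym prime_coprime // dvdn2 oddD oddX /=.
  by rewrite muln_eq0 (gtn_eqF k_gt0).
(* This is the largest [K] allowed for [n %/ 24 + 1] squares starting from the empty set. It is at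
   least [n / 2], whence [n <= K ^ 2]. *)
pose K := (n - 12 * (n %/ 24))%N.
have le_T : (K ^ (n %/ 24).+1 <= T n)%N.
  apply: leq_trans (card_queens_fixing_T n i sqr_i).
  apply: card_queens_fixing => //.
  rewrite cards0 card_ord Zp_cast // /K; lia.
have le_K : (n <= K ^ 2)%N.
  rewrite -mulnn /K.
  have := leq_trunc_div n 24; set q := (n %/ 24)%N => le_q.
  have [q0|q_gt0] := posnP q; first by rewrite q0; nia.
  by nia.
apply: leq_trans (_ : (K ^ 2) ^ (n %/ 24).+1 <= _)%N.
  by rewrite leq_exp2r.
by rewrite -expnM mulnC expnM leq_exp2r.
Qed.

Theorem theorem1 (R : realType) :
  exists c : R, 0 < c /\
    forall k : nat, (0 < k)%N ->
      let n : nat := (2 ^ (2 * k) + 1)%N in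
      n%:R `^ (c * n%:R) <= (T n)%:R.
Proof.
(* The exponent [n / 24] is for the square of [T n]; half of it is left for [T n]. *)
exists (48^-1); split=> [|k k_gt0 /=]; first by rewrite invr_gt0 ltr0n.
set n := (2 ^ (2 * k) + 1)%N.
have n_ge1 : (1 : R) <= n%:R by rewrite ler1n /n addn1.
rewrite -(@ler_pXn2r _ 2) // ?nnegrE ?powR_ge0 ?ler0n //.
(* The successor makes up for the rounding in [n %/ 24]. *)
apply: (@le_trans _ _ (n%:R ^+ (n %/ 24).+1)); last first.
  by rewrite -!natrX ler_nat (T_lower_bound k).
rewrite -!powR_mulrn ?powR_ge0 ?ler0n // -powRrM; apply: ler_powR => //.
rewrite (_ : _ * _ * _ = n%:R / 24); last by field.
rewrite ler_pdivrMr // -natrM ler_nat; lia.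
Qed.
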